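(* Let $s$ be a finite signature consisting of unary and binary relation symbols. Every hereditary class of finite structures of signature $s$ (in particular every hereditary class of finite graphs) which contains infinitely many prime structures contains a minimal prime hereditary subclass.
   Context: Structures of signature $s$ are $\mathcal R=(V,(\rho_i)_{i\in I})$ ($I$ finite), each $\rho_i$ being a binary or unary relation on $V$; they are considered up to isomorphism. Graphs are simple, undirected and loopless (viewed as structures with one symmetric irreflexive binary relation). $\mathcal R\le \mathcal R'$ (embeddability) means $\mathcal R$ is isomorphic to an induced substructure of $\mathcal R'$. A class $\mathcal C$ of finite structures is hereditary if $\mathcal R\le\mathcal R'\in\mathcal C$ implies $\mathcal R\in\mathcal C$. A module of $\mathcal R$ is a subset $A\subseteq V$ such that for all $a,a'\in A$, $x\in V\setminus A$ and all $i\in I$ with $\rho_i$ binary: $(x\rho_i a\Leftrightarrow x\rho_i a')$ and $(a\rho_i x\Leftrightarrow a'\rho_i x)$ (unary relations impose no condition). The empty set, singletons and $V$ are the trivial modules; $\mathcal R$ is prime if it has no nontrivial module. A hereditary class $\mathcal C$ is minimal prime if it contains infinitely many prime structures (up to isomorphism), while every proper hereditary subclass contains only finitely many prime structures. *)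

(* Defs.v *)
From mathcomp Require Import all_boot.

Set Implicit Arguments.
Unset Strict Implicit.
Unset Printing Implicit Defensive.

(* The index set of the signature is the disjoint union of [usym] (unary
   symbols) and [bsym] (binary symbols). *)
Record signature := Signature { usym : finType; bsym : finType }.

Record structure (s : signature) := Structure {
  vert :> finType;
  urel : usym s -> pred vert;
  brel : bsym s -> rel vert
}.

Arguments urel {s} R i x : rename.
Arguments brel {s} R i x y : rename.

Section Structures.
Variable s : signature.
Implicit Types R S : structure s.

Definition isomorphic R S : Prop :=
  exists f : R -> S,
    [/\ bijective f,
        forall i x, urel S i (f x) = urel R i x
      & forall i x y, brel S i (f x) (f y) = brel R i x y].

Definition induced R (A : {set R}) : structure s :=
  @Structure s {x : R | x \in A}
    (fun i x => urel R i (val x))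
    (fun i x y => brel R i (val x) (val y)).

Definition embeds R S : Prop := exists A : {set S}, isomorphic R (induced A).

Definition is_module R (A : {set R}) : Prop :=
  forall a a' x i, a \in A -> a' \in A -> x \notin A ->
    brel R i x a = brel R i x a' /\ brel R i a x = brel R i a' x.

Definition trivial_module R (A : {set R}) : Prop :=
  [\/ A = set0, exists x, A = [set x] | A = setT].

Definition prime_structure R : Prop :=
  forall A : {set R}, is_module A -> trivial_module A.

(* No closure under isomorphism is required here; for hereditary classes it is
   automatic. *)
Definition class := structure s -> Prop.

Definition hereditary (C : class) : Prop :=
  forall R S, embeds R S -> C S -> C R.

Definition subclass (D C : class) : Prop := forall R, D R -> C R.

Definition proper_subclass (D C : class) : Prop :=
  subclass D C /\ ~ subclass C D.

(* Finiteness is up to isomorphism: finitely many representatives suffice. *)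
Definition finitely_many_primes (C : class) : Prop :=
  exists (n : nat) (P : 'I_n -> structure s),
    forall R, C R -> prime_structure R -> exists k, isomorphic R (P k).

Definition infinitely_many_primes (C : class) : Prop :=
  ~ finitely_many_primes C.

Definition minimal_prime (C : class) : Prop :=
  [/\ hereditary C,
      infinitely_many_primes C
    & forall D, hereditary D -> proper_subclass D C -> finitely_many_primes D].

End Structures.

Definition graph_sig : signature := Signature void unit.

Definition is_graph (G : structure graph_sig) : Prop :=
  symmetric (brel G tt) /\ irreflexive (brel G tt).

(* Main.v *)
Require Import Defs.
From mathcomp Require Import all_boot.
From mathcomp Require Import boolp.
Set Implicit Arguments.
Unset Strict Implicit.
Unset Printing Implicit Defensive.

(** A hereditary class [D] with infinitely many primes is minimal prime as soon
    as avoiding any single member [R] of [D] leaves only finitely many primes: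
    a hereditary proper subclass misses some such [R], hence every structure
    above [R]. One therefore lists all finite structures up to isomorphism as
    [E 0, E 1, ...], starts from the given class, and at stage [k] discards
    the structures above [E k] whenever infinitely many primes remain
    afterwards. The intersection of the classes so obtained has the
    minimality property by construction; what needs an argument is that it
    still contains infinitely many primes.

    That argument is compactness, and it rests on the primes having no large
    gaps: a prime structure with at least [m] elements, [m > 2], contains a
    prime one with [m] or [m.+1] elements ([prime_of_size]). Hence each class
    of the chain contains a prime of one of these two sizes, there are finitely
    many isomorphism types to choose from, and a chain of classes each meeting
    a finite set has a common element in it ([chain_inter_infinitely_many]).
    So the intersection contains primes of arbitrarily large size.

    The absence of gaps has two parts. A prime structure with at least three
    elements contains a prime one with three or four ([small_prime]): otherwise
    it would split into two nonempty parts [A] and [B] all of whose pairs look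
    alike ([split_of_no_small_prime]), and both parts would be modules.
    A proper prime substructure with at least three elements can be enlarged by
    one or two elements to a prime one, a theorem of Ehrenfeucht and Rozenberg
    ([prime_extension]).

    Modules only depend on which ordered pairs satisfy the same binary
    relations in both directions, so all this combinatorics is carried out for
    a colouring [c] of pairs such that [c x y] determines [c y x]. *)

(** * Modules of coloured pairs *)

Section Colours.
Variables (T : finType) (K : eqType) (c : T -> T -> K).
Hypothesis c_rev : forall x y u v, c x y = c u v -> c y x = c v u.
Implicit Types (X Y M A : {set T}) (a b u v x y z : T).

(** Comparing [c x a] with [c x b] alone covers both directions of the
    definition of a module, thanks to [c_rev]. *)
Definition module_in X M :=
  forall a b x, a \in M -> b \in M -> x \in X -> x \notin M -> c x a = c x b.

Definition prime_in X :=
  forall M, M \subset X -> module_in X M -> 1 < #|M| -> M = X.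

Lemma nonprime_module X :
  ~ prime_in X ->
  exists M, [/\ M \subset X, module_in X M, 1 < #|M| & M <> X].
Proof.
move=> npX; apply: contrapT => noM; apply: npX => M sMX modM M_gt1.
by apply: contrapT => neqM; apply: noM; exists M.
Qed.

Lemma nonprime_triple x y z :
  ~ prime_in [set x; y; z] -> [\/ c x y = c x z, c y x = c y z | c z x = c z y].
Proof.
move=> /nonprime_module[M [sM modM /card_gt1P[p [q [pM qM pq]]] neqM]].
have /subsetPn[r rX rM] : ~~ ([set x; y; z] \subset M).
  by apply/negP => sXM; apply: neqM; apply/eqP; rewrite eqEsubset sM.
have := modM p q r pM qM rX rM.
have pr : p != r by apply: contraNneq rM => <-.
have qr : q != r by apply: contraNneq rM => <-.
have [pX qX] := (subsetP sM p pM, subsetP sM q qM).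
move: pX qX rX pq pr qr; rewrite !inE.
by do 3![case/orP=> [/orP[]|] /eqP->]; rewrite ?eqxx // => _ _ _ e;
  by [apply: Or31 | apply: Or32 | apply: Or33].
Qed.

(** The path on four vertices is a prime graph, and [e] identifies what [c]
    identifies, so every [c]-module is an [e]-module. *)
Lemma path_prime (e : rel T) x y z t :
    symmetric e -> (forall u v w, c u v = c u w -> e u v = e u w) ->
    e x y -> e y z -> e z t -> ~~ e x z -> ~~ e x t -> ~~ e y t ->
  prime_in [set x; y; z; t].
Proof.
move=> eC ec xy yz zt xz xt yt M sM modM /card_gt1P[p [q [pM qM pq]]].
have sep a b d : d \in [set x; y; z; t] -> e d a -> ~~ e d b ->
    a \in M -> b \in M -> d \in M.
  move=> dX da db aM bM; apply: contraT => dM.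
  by move: da; rewrite (ec _ _ _ (modM _ _ _ aM bM dX dM)) (negPf db).
have [px [py [pz pt]]] : x \in [set x; y; z; t] /\ y \in [set x; y; z; t] /\
  z \in [set x; y; z; t] /\ t \in [set x; y; z; t] by rewrite !inE !eqxx ?orbT.
move: (yt); rewrite eC => ty; move: (xt); rewrite eC => tx.
move: (xz); rewrite eC => zx; move: (yz); rewrite eC => zy.
move: (zt); rewrite eC => tz; move: (xy); rewrite eC => yx.
(* Any two vertices of the path are separated by a vertex outside the pair. *)
have xyM : x \in M -> y \in M -> z \in M by move=> ? ?; apply: (sep y x).
have yzM : y \in M -> z \in M -> x \in M by move=> ? ?; apply: (sep y z).
have ztM : z \in M -> t \in M -> y \in M by move=> ? ?; apply: (sep z t).
have yzM' : y \in M -> z \in M -> t \in M by move=> ? ?; apply: (sep z y).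
have xzM : x \in M -> z \in M -> t \in M by move=> ? ?; apply: (sep z x).
have ytM : y \in M -> t \in M -> x \in M by move=> ? ?; apply: (sep y t).
have xtM : x \in M -> t \in M -> y \in M by move=> ? ?; apply: (sep x t).
suff sXM : [set x; y; z; t] \subset M by apply/eqP; rewrite eqEsubset sM.
suff [xM yM zM tM] : [/\ x \in M, y \in M, z \in M & t \in M].
  by apply/subsetP => d; rewrite !inE => /orP[/orP[/orP[]|]|] /eqP->.
have [pX qX] := (subsetP sM p pM, subsetP sM q qM).
move: pX qX pq pM qM xyM yzM ztM yzM' xzM ytM xtM; rewrite !inE.
do 2![case/orP=> [/orP[/orP[]|]|] /eqP->]; rewrite ?eqxx // => _ -> -> *;
  by split; auto.
Qed.

(** * Prime subsets with three or four elements *)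

(** This generalizes the fact that a graph without induced path on four
    vertices is disconnected or has a disconnected complement. By induction,
    [Y] minus a point [x] splits into [A] and [B] with all pairs of colour [k].
    Call a point of [A] or [B] good if its pair with [x], taken in the same
    direction as [A] to [B], has colour [k]. If all of [A] or all of [B] is
    good, then [x] joins the opposite part. Otherwise the triples force all bad
    points to have one and the same colour from [x], and a pair formed by a good
    and a bad point of [A] (or of [B]) must have colour [k], for else it would
    lie on a path with [x] and a bad point of the other part. So the good points
    of [A], or those of [B], can be split off; and if there are none, [x]
    can. *)
Lemma split_of_no_small_prime Y :
    (forall Z : {set T}, Z \subset Y -> 2 < #|Z| <= 4 -> ~ prime_in Z) ->
    1 < #|Y| ->
  exists A k, [/\ A != set0, A \proper Y &
    forall a b, a \in A -> b \in Y :\: A -> c a b = k].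
Proof.
have [n leYn] := ubnP #|Y|; elim: n Y leYn => // n IHn Y leYn npY Y_gt1.
have [x xY] : exists x, x \in Y by apply/card_gt0P; apply: ltnW.
have cardY : #|Y| = #|Y :\ x|.+1 by rewrite (cardsD1 x) xY.
have [Y'_gt1 | Y'_le1] := ltnP 1 #|Y :\ x|; last first.
  have /cards1P[q defY'] : #|Y :\ x| == 1.
    by rewrite eqn_leq Y'_le1 -ltnS -cardY.
  exists [set x], (c x q); split.
  - by apply/set0Pn; exists x; rewrite inE.
  - by rewrite properEcard sub1set xY cards1.
  - by move=> a b /set1P->; rewrite defY' => /set1P->.
have [||A [k [A0 ltAY' cAB]]] := IHn (Y :\ x) _ _ Y'_gt1.
- by rewrite -ltnS; apply: leq_trans leYn; rewrite cardY.
- by move=> Z sZ; apply: npY; apply: subset_trans sZ (subD1set _ _).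
have sAY' := proper_sub ltAY'; have sAY := subset_trans sAY' (subD1set Y x).
have xA : x \notin A by apply/negP => /(subsetP sAY'); rewrite !inE eqxx.
have ltAY : A \proper Y by apply: proper_sub_trans ltAY' (subD1set _ _).
pose B := Y :\ x :\: A.
have sBY : B \subset Y by apply: subset_trans (subsetDl _ _) (subD1set _ _).
have AB a b : a \in A -> b \in B -> c a b = k by apply: cAB.
have xB : x \notin B by rewrite !inE eqxx !andbF.
have YE y : y \in Y -> [\/ y = x, y \in A | y \in B].
  move=> yY; have [->|yx] := eqVneq y x; first exact: Or31.
  have [yA|yA] := boolP (y \in A); first exact: Or32.
  by apply: Or33; rewrite !inE yA yx.
have [[a [aA ax]]|allA] :=
  pselect (exists a, a \in A /\ c a x <> k); last first.
  exists A, k; split=> // a y aA; rewrite inE => /andP[yA /YE[->||yB]].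
  - by apply: contrapT => ax; apply: allA; exists a.
  - by rewrite (negPf yA).
  - exact: AB.
have [[b [bB bx]]|allB] :=
  pselect (exists b, b \in B /\ c x b <> k); last first.
  exists (x |: A), k; split.
  - by apply/set0Pn; exists x; rewrite setU11.
  - rewrite properE subUset sub1set xY sAY /=; apply/subsetPn.
    have /properP[_ [b bY' bA]] := ltAY'; exists b; first by case/setD1P: bY'.
    by rewrite inE negb_or bA inE andbT; case/setD1P: bY'.
  - move=> d y; rewrite !inE negb_or => dA /andP[/andP[yx yA] /YE[e||yB]].
    + by rewrite e eqxx in yx.
    + by rewrite (negPf yA).
    + case/orP: dA => [/eqP->|dA]; last exact: AB.
      by apply: contrapT => xb; apply: allB; exists y.
(* Paths of [e] are sought among the pairs coloured [k] in neither direction. *)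
pose e : rel T := fun u v => (c u v != k) && (c v u != k).
have eC : symmetric e by move=> u v; rewrite /e andbC.
have ec u v w : c u v = c u w -> e u v = e u w.
  by move=> euvw; rewrite /e euvw (c_rev euvw).
have AY := subsetP sAY; have BY := subsetP sBY.
have neqAx u : u \in A -> u != x by apply: contraTneq => ->.
have neqxB u : u \in B -> x != u by apply: contraTneq => <-.
have neqAB u v : u \in A -> v \in B -> u != v.
  by move=> uA; apply: contraTneq => <-; rewrite inE uA.
have triple u v w : u \in Y -> v \in Y -> w \in Y -> u != v -> v != w ->
    u != w -> [\/ c u v = c u w, c v u = c v w | c w u = c w v].
  move=> uY vY wY uv vw uw; apply: nonprime_triple; apply: npY.
    by rewrite !subUset !sub1set uY vY wY.
  by rewrite setUC cardsU1 cards2 !inE negb_or uv ![w == _]eq_sym uw vw.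
have no_path u v w z : u \in Y -> v \in Y -> w \in Y -> z \in Y ->
    u != v -> v != w -> w != z -> u != w -> u != z -> v != z ->
    e u v -> e v w -> e w z ->
    c u w = k -> c u z = k -> c v z = k -> False.
  move=> uY vY wY zY uv vw wz uw uz vz euv evw ewz kuw kuz kvz.
  apply: (npY [set u; v; w; z]).
  - by rewrite !subUset !sub1set uY vY wY zY.
  - rewrite setUC cardsU1 setUC cardsU1 cards2 !inE !negb_or uv.
    by rewrite ![w == _]eq_sym ![z == _]eq_sym uw vw uz vz wz.
  - by apply: (@path_prime e) => //; rewrite /e ?kuw ?kuz ?kvz eqxx.
(* The bad points of [A] and those of [B] all look alike from [x]. *)
have same u v : u \in A -> v \in B -> c u x <> k -> c x v <> k -> c x u = c x v.
  move=> uA vB ux xv.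
  case: (triple u v x (AY u uA) (BY v vB) xY (neqAB u v uA vB)) => //.
  - by rewrite eq_sym neqxB.
  - exact: neqAx.
  - by rewrite AB // => kux; case: ux.
  - by move/c_rev; rewrite AB // => kxv; case: xv.
have ab := same _ _ aA bB ax bx.
have exb v : v \in B -> c x v <> k -> e x v.
  move=> vB xv; apply/andP; split; first exact/eqP.
  by rewrite (c_rev (esym (same _ _ aA vB ax xv))); apply/eqP.
have eux u : u \in A -> c u x <> k -> e u x.
  move=> uA ux; apply/andP; split; first exact/eqP.
  by rewrite (same _ _ uA bB ux bx); apply/eqP.
(* The good points of [A] point to its bad ones with colour [k]: the
   alternative is the path [a', u, x, b]. *)
have Ak a' u : a' \in A -> u \in A -> c a' x = k -> c u x <> k -> c a' u = k.
  move=> a'A uA a'x ux; have a'u : a' != u by apply: contra_notN ux => /eqP <-.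
  have [||] := triple _ _ _ (AY a' a'A) (AY u uA) xY a'u (neqAx u uA)
    (neqAx a' a'A).
  - by rewrite a'x.
  - move=> ea'; have ea'u : e a' u by rewrite eC (ec _ _ _ ea'); apply: eux.
    have := no_path _ _ _ _ (AY a' a'A) (AY u uA) xY (BY b bB) a'u (neqAx u uA)
      (neqxB b bB) (neqAx a' a'A) (neqAB a' b a'A bB) (neqAB u b uA bB) ea'u
      (eux u uA ux) (exb b bB bx) a'x (AB a' b a'A bB) (AB u b uA bB).
    by [].
  - by move/c_rev; rewrite a'x => /esym.
(* The mirror image in [B]; the path is [a, x, v, b']. *)
have Bk v b' : v \in B -> b' \in B -> c x v <> k -> c x b' = k -> c v b' = k.
  move=> vB b'B xv b'x; have vb' : v != b' by apply: contra_notN xv => /eqP ->.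
  have [||] := triple _ _ _ xY (BY v vB) (BY b' b'B) (neqxB v vB) vb'
    (neqxB b' b'B).
  - by rewrite b'x.
  - move=> eb'; have evb' : e v b' by rewrite -(ec _ _ _ eb') eC; apply: exb.
    have := no_path _ _ _ _ (AY a aA) xY (BY v vB) (BY b' b'B) (neqAx a aA)
      (neqxB v vB) vb' (neqAB a v aA vB) (neqAB a b' aA b'B) (neqxB b' b'B)
      (eux a aA ax) (exb v vB xv) evb' (AB a v aA vB) (AB a b' aA b'B) b'x.
    by [].
  - by move/c_rev; rewrite b'x.
have [[a' [a'A a'x]]|noA] := pselect (exists a', a' \in A /\ c a' x = k).
  exists [set u in A | c u x == k], k; split.
  - by apply/set0Pn; exists a'; rewrite inE a'A a'x eqxx.
  - apply: sub_proper_trans ltAY; apply/subsetP => u.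
    by rewrite inE => /andP[].
  - move=> u y; rewrite !inE => /andP[uA /eqP ux] /andP[yA1 /YE[->|yA|yB]] //.
    + by apply: Ak => // yx; rewrite yA yx eqxx in yA1.
    + exact: AB.
have [[b' [b'B b'x]]|noB] := pselect (exists b', b' \in B /\ c x b' = k).
  exists (Y :\: [set v in B | c x v == k]), k; split.
  - by apply/set0Pn; exists x; rewrite in_setD xY inE (negPf xB).
  - rewrite properE subsetDl; apply/subsetPn; exists b'; first exact: BY.
    by rewrite in_setD negb_and inE b'B b'x eqxx.
  - move=> y v; rewrite setDDr setDv set0U !in_setI in_setD.
    move=> /andP[yB1 /YE yY] /andP[_ ]; rewrite inE => /andP[vB /eqP xv].
    case: yY => [->|yA|yB]//; first exact: AB.
    by apply: Bk => // xy; rewrite inE yB xy eqxx in yB1.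
exists [set x], (c x a); split.
- by apply/set0Pn; exists x; rewrite inE.
- by rewrite properEcard sub1set xY cards1.
- move=> _ y /set1P->; rewrite in_setD1 => /andP[yx /YE[e'|yA|yB]].
  + by rewrite e' eqxx in yx.
  + by rewrite ab; apply: same => // xy; apply: noA; exists y.
  + by apply/esym/same => // xy; apply: noB; exists y.
Qed.

Lemma small_prime :
  prime_in setT -> 2 < #|T| -> exists2 Z : {set T}, 2 < #|Z| <= 4 & prime_in Z.
Proof.
move=> pT T_gt2; apply: contrapT => noZ.
have [||A [k [A0 ltA cA]]] := @split_of_no_small_prime setT.
- by move=> Z _ sizeZ pZ; apply: noZ; exists Z.
- by rewrite cardsT ltnW.
have [A_gt1|A_le1] := ltnP 1 #|A|.
  suff defA : A = setT by rewrite defA properxx in ltA.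
  apply: pT => // a b x aA bA _ xA.
  by apply: c_rev; rewrite !cA // !inE xA.
(* [A] is a singleton, so its complement is a module with two points. *)
have cardC := cardsC A.
suff defA : ~: A = setT.
  by case/set0Pn: A0 => a aA; have := in_setT a; rewrite -defA inE aA.
apply: pT; first exact: subsetT.
  by move=> a b x; rewrite !inE negbK => aA bA _ xA;
    rewrite !cA // !inE ?aA ?bA.
by rewrite -(ltn_add2l #|A|) cardC addn1; apply: leq_ltn_trans T_gt2.
Qed.

(** * Enlarging a prime subset *)

Section Extension.
Variable X : {set T}.
Hypotheses (pX : prime_in X) (X_gt2 : 2 < #|X|).

(** For [v] outside [X]: [X] is a module of [v |: X]. *)
Definition dominates v := [forall a in X, forall b in X, c v a == c v b].

(** For [v] outside [X] and [u] in [X]: [[set u; v]] is a module of [v |: X]. *)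
Definition twin u v := [forall z in X, (z != u) ==> (c z u == c z v)].

Lemma dominatesP v :
  reflect {in X &, forall a b, c v a = c v b} (dominates v).
Proof.
apply: (iffP forall_inP) => [dv a b aX bX | dv a aX].
  by move/forall_inP: (dv a aX) => /(_ b bX)/eqP.
by apply/forall_inP => b bX; apply/eqP/dv.
Qed.

Lemma twinP u v :
  reflect {in X, forall z, z != u -> c z u = c z v} (twin u v).
Proof.
apply: (iffP forall_inP) => [tv z zX zu | tv z zX].
  by apply/eqP; move/implyP: (tv z zX); apply.
by apply/implyP => /(tv z zX) ->.
Qed.

(** Otherwise [u] would look at the rest of [X] as [v] does, so that [X :\ u]
    would be a module of [X]. *)
Lemma dominates_no_twin u v : u \in X -> dominates v -> ~~ twin u v.
Proof.
move=> uX /dominatesP dv; apply/negP => /twinP tv.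
suff defX : X :\ u = X by rewrite -defX !inE eqxx in uX.
apply: pX; first exact: subD1set.
  move=> a b x /setD1P[au aX] /setD1P[bu bX] xX.
  rewrite in_setD1 xX andbT negbK => /eqP->.
  by rewrite (c_rev (tv a aX au)) (c_rev (tv b bX bu)) (dv a b).
by rewrite -ltnS; move: X_gt2; rewrite (cardsD1 u) uX.
Qed.

(** Two twins of [v] would form a module of [X]. *)
Lemma twin_inj u w v :
  u \in X -> w \in X -> twin u v -> twin w v -> u = w.
Proof.
move=> uX wX /twinP tu /twinP tw; apply: contrapT => /eqP uw.
suff defX : [set u; w] = X by have := X_gt2; rewrite -defX cards2 uw.
apply: pX; last by rewrite cards2 uw.
  by rewrite subUset !sub1set uX.
move=> a b x aM bM xX; rewrite !inE negb_or => /andP[xu xw].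
have cx y : y \in [set u; w] -> c x y = c x v.
  by rewrite !inE => /orP[]/eqP->; [apply: tu | apply: tw].
by rewrite (cx a aM) (cx b bM).
Qed.

(** The trace on [X] of a module is a module of [X], hence trivial. *)
Lemma module_trace M Y :
    X \subset Y -> module_in Y M ->
  [\/ X \subset M, M :&: X = set0 | exists2 u, u \in X & M :&: X = [set u]].
Proof.
move=> sXY modM; have [MX_gt1|] := ltnP 1 #|M :&: X|.
  apply: Or31; apply/setIidPr; apply: pX => //; first exact: subsetIr.
  move=> a b x /setIP[aM _] /setIP[bM _] xX.
  by rewrite in_setI xX andbT; apply: modM => //; apply: (subsetP sXY).
rewrite leq_eqVlt ltnS leqn0 => /orP[/cards1P[u defu]|]; last first.
  by rewrite cards_eq0 => /eqP; apply: Or32.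
by apply: Or33; exists u => //; have := set11 u; rewrite -defu => /setIP[].
Qed.

Lemma nonprime_add1 v : v \notin X -> ~ prime_in (v |: X) ->
  dominates v \/ exists2 u, u \in X & twin u v.
Proof.
move=> vX /nonprime_module[M [sM modM /card_gt1P[p [q [pM qM pq]]] neqM]].
case: (module_trace (subsetUr [set v] X) modM) => [sXM|M0|[u uX defu]].
- have vM : v \notin M.
    apply: contra_notN neqM => vM; apply/eqP.
    by rewrite eqEsubset sM subUset sub1set vM.
  left; apply/dominatesP => a b aX bX.
  by apply: modM => //; rewrite ?setU11 ?(subsetP sXM).
- have isv t : t \in M -> t = v.
    move=> tM; have := subsetP sM t tM; rewrite in_setU1 => /orP[/eqP//|tX].
    by have := in_set0 t; rewrite -M0 inE tM tX.
  by rewrite (isv p pM) (isv q qM) eqxx in pq.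
- have inM t : t \in M -> t = v \/ t = u.
    move=> tM; have := subsetP sM t tM; rewrite in_setU1 => /orP[/eqP|tX].
      by left.
    by right; apply/set1P; rewrite -defu inE tM.
  have uM : u \in M by have := set11 u; rewrite -defu => /setIP[].
  have vM : v \in M.
    case: (inM p pM) (inM q qM) => [<- //|ep] [<- //|eq].
    by rewrite ep eq eqxx in pq.
  right; exists u => //; apply/twinP => z zX zu.
  apply: modM => //; first by rewrite in_setU1 zX orbT.
  by apply: contraNN zu => zM; rewrite -in_set1 -defu inE zM.
Qed.

(** The shapes of a nontrivial module [M] of [x |: (y |: X)]: in the first three
    cases [M] contains [X] and misses [x], [y] or both; in the fourth
    [M = [set x; y]]; in the last three [M] meets [X] in [u] only. *)
Inductive add2_obstruction x y : Prop :=
| BothDominate of dominates x & dominates y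
| LeftDominates of dominates x & {in X, forall a, c x a = c x y}
| RightDominates of dominates y & {in X, forall a, c y a = c y x}
| SameTrace of {in X, forall z, c z x = c z y}
| BothTwins u of u \in X & twin u x & twin u y
| LeftTwin u of u \in X & twin u x & c y u = c y x
| RightTwin u of u \in X & twin u y & c x u = c x y.

Lemma nonprime_add2 x y :
    x \notin X -> y \notin X -> ~ prime_in (x |: (y |: X)) ->
  add2_obstruction x y.
Proof.
move=> xX yX /nonprime_module[M [sM modM /card_gt1P[p [q [pM qM pq]]] neqM]].
set Y := x |: (y |: X) in sM modM neqM.
have xY : x \in Y by rewrite !inE eqxx.
have yY : y \in Y by rewrite !inE eqxx orbT.
have XY z : z \in X -> z \in Y by move=> zX; rewrite !inE zX !orbT.
have inM t : t \in M -> [\/ t = x, t = y | t \in M :&: X].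
  move=> tM; rewrite inE tM; have := subsetP sM t tM; rewrite !inE.
  by case/or3P => [/eqP|/eqP|]; [apply: Or31|apply: Or32|apply: Or33].
have sXY : X \subset Y by apply/subsetP.
case: (module_trace sXY modM) => [/subsetP sXM|M0|[u uX defu]].
- have [xM|xM] := boolP (x \in M); have [yM|yM] := boolP (y \in M).
  + case: neqM; apply/eqP; rewrite eqEsubset sM !subUset !sub1set xM yM.
    by apply/subsetP.
  + apply: RightDominates; last by move=> a aX; apply: modM => //; apply: sXM.
    by apply/dominatesP => a b aX bX; apply: modM => //; apply: sXM.
  + apply: LeftDominates; last by move=> a aX; apply: modM => //; apply: sXM.
    by apply/dominatesP => a b aX bX; apply: modM => //; apply: sXM.
  + apply: BothDominate; apply/dominatesP => a b aX bX;
      by apply: modM => //; apply: sXM.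
- have notM z : z \in X -> z \notin M.
    by move=> zX; apply/negP => zM; have := in_set0 z; rewrite -M0 inE zM zX.
  have eqc z : z \in X -> c z p = c z q.
    by move=> zX; apply: modM => //; [apply: XY | apply: notM].
  apply: SameTrace => z /eqc; move: (inM p pM) (inM q qM) pq.
  by rewrite M0 !in_set0 => -[->|->|//] [->|->|//]; rewrite ?eqxx.
- have uM : u \in M by have := set11 u; rewrite -defu => /setIP[].
  have mtwin t : t \in M -> twin u t.
    move=> tM; apply/twinP => z zX zu; apply: modM => //; first exact: XY.
    by apply: contraNN zu => zM; rewrite -in_set1 -defu inE zM.
  have [xM|xM] := boolP (x \in M); have [yM|yM] := boolP (y \in M).
  + by apply: (@BothTwins _ _ u) => //; apply: mtwin.
  + by apply: (@LeftTwin _ _ u) => //; [apply: mtwin | apply: modM].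
  + by apply: (@RightTwin _ _ u) => //; [apply: mtwin | apply: modM].
  + have isu t : t \in M -> t = u.
      move=> tM; case: (inM t tM) => [e|e|]; last by rewrite defu => /set1P.
        by rewrite -e tM in xM.
      by rewrite -e tM in yM.
    by rewrite (isu p pM) (isu q qM) eqxx in pq.
Qed.

(** Suppose that adding one or two points to [X] never yields a prime subset.
    Then every outside point dominates [X] or is a twin of a point of [X]. If
    some point dominates [X], the set of all points that do not is a module:
    the obstruction to adding a dominating point together with a point that
    does not dominate is always that the former does not tell the latter from
    some point of [X], hence from any. Otherwise some
    [u] in [X] has a twin, and [u] with all its twins is a module for a
    similar reason. Both contradict the primality of the whole set. *)
Lemma prime_extension :
    prime_in setT -> X != setT ->
  exists2 Y : {set T}, #|X| < #|Y| <= #|X|.+2 & prime_in Y.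
Proof.
move=> pT neqXT; apply: contrapT => noY.
have np1 v : v \notin X -> ~ prime_in (v |: X).
  move=> vX pv; apply: noY; exists (v |: X) => //.
  by rewrite cardsU1 vX add1n ltnSn leqnSn.
have np2 x y : x \notin X -> y \notin X -> x != y -> add2_obstruction x y.
  move=> xX yX xy; apply: nonprime_add2 => // pxy.
  apply: noY; exists (x |: (y |: X)) => //.
  by rewrite !cardsU1 !inE negb_or xy xX yX !add1n ltnS leqnSn leqnn.
have [a0 [b0 [a0X b0X a0b0]]] : exists a b, [/\ a \in X, b \in X & a != b].
  by apply/card_gt1P; apply: ltnW.
have [t0 _ t0X] : exists2 t, t \in setT & t \notin X.
  by apply/subsetPn; rewrite subTset.
have [[x xX dx]|nodom] := pselect (exists2 x, x \notin X & dominates x).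
  pose N := [set v | (v \in X) || ~~ dominates v].
  have cN z v : z \notin N -> v \in N -> c z v = c z a0.
    rewrite !inE negb_or negbK => /andP[zX dz] /orP[vX|ndv].
      by apply: (dominatesP _ dz).
    have [vX|vX] := boolP (v \in X); first by apply: (dominatesP _ dz).
    have zv : z != v by apply: contraNneq ndv => <-.
    case: (np2 z v zX vX zv) => [_|_ ->//||same|u uX|u uX|u uX _ e];
      rewrite ?(negPf ndv) //.
    - case/negP: ndv; apply/dominatesP => a b aX bX.
      rewrite -(c_rev (same a aX)) -(c_rev (same b bX)).
      exact: (dominatesP _ dz).
    - by rewrite (negPf (dominates_no_twin uX dz)).
    - by rewrite (negPf (dominates_no_twin uX dz)).
    - by rewrite -e; apply: (dominatesP _ dz).
  have xN : x \notin N by rewrite inE negb_or xX dx.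
  suff defN : N = setT by rewrite defN inE in xN.
  apply: pT; first exact: subsetT.
    by move=> a b z aN bN _ zN; rewrite !cN.
  by apply/card_gt1P; exists a0, b0; rewrite !inE a0X b0X.
have ndom v : v \notin X -> ~~ dominates v.
  by move=> vX; apply/negP => dv; apply: nodom; exists v.
have twinned v : v \notin X -> exists2 u, u \in X & twin u v.
  move=> vX; case: (nonprime_add1 vX (np1 v vX)) => // dv.
  by case/negP: (ndom v vX).
have [u uX tu] := twinned t0 t0X.
pose N := [set v | (v == u) || (v \notin X) && twin u v].
have cN z v : z \notin N -> v \in N -> c z v = c z u.
  rewrite !inE negb_or negb_and negbK.
  move=> /andP[zu zN] /orP[/eqP->//|/andP[vX tv]].
  have [zX|zX] := boolP (z \in X); first by rewrite (twinP _ _ tv).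
  have ntz : ~~ twin u z by rewrite (negPf zX) in zN.
  have vz : v != z by apply: contraNneq ntz => <-.
  case: (np2 v z vX zX vz) => [dv|dv|dz|same|w wX tw tw'|w wX tw e|w wX tw e].
  - by case/negP: (ndom v vX).
  - by case/negP: (ndom v vX).
  - by case/negP: (ndom z zX).
  - case/negP: ntz; apply/twinP => t tX tu'.
    by rewrite -same //; apply: (twinP _ _ tv).
  - by rewrite (twin_inj uX wX tv tw) tw' in ntz.
  - by rewrite (twin_inj uX wX tv tw).
  - have wu : w != u by apply: contraNneq ntz => <-.
    have uw : u != w by rewrite eq_sym.
    (* [v] and [z] are twins of distinct points [u] and [w]: move [z] to [w],
       then [v] to [u], then [w] back to [z]. *)
    rewrite -(c_rev e) -(twinP _ _ tv w wX wu).
    by rewrite (c_rev (twinP _ _ tw u uX uw)).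
suff defN : N = setT.
  have [w wX wu] : exists2 w, w \in X & w != u.
    have [e|] := eqVneq a0 u; last by exists a0.
    by exists b0; rewrite // -e eq_sym.
  by have := in_setT w; rewrite -defN inE (negPf wu) wX.
apply: pT; first exact: subsetT.
  by move=> a b z aN bN _ zN; rewrite !cN.
apply/card_gt1P; exists u, t0; rewrite !inE eqxx t0X tu orbT; split=> //.
by apply: contraNneq t0X => <-.
Qed.

End Extension.

Lemma prime_of_size m :
    prime_in setT -> 2 < m <= #|T| ->
  exists2 Y : {set T}, m <= #|Y| <= m.+1 & prime_in Y.
Proof.
move=> pT /andP[m_gt2]; elim: m m_gt2 => // m IHm.
rewrite ltnS leq_eqVlt => /predU1P[<- T_gt2|m_gt2 leT].
  exact: small_prime.
have [Y /andP[mY Ym] pY] := IHm m_gt2 (ltnW leT).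
have [Y_gtm|Y_lem] := ltnP m #|Y|.
  by exists Y; rewrite // Y_gtm (leq_trans Ym).
have cardY : #|Y| = m by apply/eqP; rewrite eqn_leq Y_lem.
case: (@prime_extension Y) => // [||Z].
- by rewrite cardY.
- by apply: contraTneq leT => defY; rewrite -cardsT -defY cardY ltnn.
- by rewrite cardY => sizeZ pZ; exists Z.
Qed.

End Colours.

(** * Structures, isomorphism and enumeration *)

Section Structures.
Variable s : signature.
Implicit Types (R S : structure s) (C D : class s).

(** Both directions are recorded, so that the colour of a pair determines that
    of the reversed pair. *)
Definition color R (x y : R) : {ffun bsym s -> bool * bool} :=
  [ffun i => (brel R i x y, brel R i y x)].

Lemma color_eqP R (x y u v : R) :
  color x y = color u v <->
  forall i, brel R i x y = brel R i u v /\ brel R i y x = brel R i v u.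
Proof.
split=> [/ffunP e i | e]; first by have := e i; rewrite !ffunE => -[].
by apply/ffunP => i; rewrite !ffunE; have [-> ->] := e i.
Qed.

Lemma color_rev R (x y u v : R) :
  color x y = color u v -> color y x = color v u.
Proof. by move=> /color_eqP e; apply/color_eqP => i; have [] := e i. Qed.

Lemma prime_in_setT R : prime_structure R -> prime_in (@color R) setT.
Proof.
move=> pR M _ modM M_gt1.
have [|M0|[x Mx]|//] := pR M.
- move=> a a' x i aM a'M xM; have e := modM a a' x aM a'M (in_setT x) xM.
  by case/color_eqP/(_ i): e.
- by rewrite M0 cards0 in M_gt1.
- by rewrite Mx cards1 in M_gt1.
Qed.

Lemma prime_induced R (X : {set R}) :
  prime_in (@color R) X -> prime_structure (induced X).
Proof.
move=> pX A modA; pose M := [set val x | x in A].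
have [A_gt1|] := ltnP 1 #|A|; last first.
  rewrite leq_eqVlt ltnS leqn0 => /orP[/cards1P[x ->]|].
    by apply: Or32; exists x.
  by rewrite cards_eq0 => /eqP ->; apply: Or31.
apply: Or33; apply/setP => x; rewrite in_setT.
suff defM : M = X.
  have : val x \in M by rewrite defM (valP x).
  by rewrite mem_imset //; apply: val_inj.
apply: pX; last by rewrite card_imset //; apply: val_inj.
  by apply/subsetP => _ /imsetP[y _ ->]; apply: valP.
move=> _ _ z /imsetP[a aA ->] /imsetP[b bA ->] zX zM.
have zA : Sub z zX \notin A.
  by apply: contra zM => zA; apply/imsetP; exists (Sub z zX).
by apply/color_eqP => i; apply: (modA a b (Sub z zX) i).
Qed.

Lemma isomorphic_refl R : isomorphic R R.
Proof. by exists id; split=> //; exists id. Qed.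

Lemma isomorphic_sym R S : isomorphic R S -> isomorphic S R.
Proof.
case=> f [[g fK gK] fu fb]; exists g; split; first by exists f.
- by move=> i x; rewrite -fu gK.
- by move=> i x y; rewrite -fb !gK.
Qed.

Lemma isomorphic_trans S R R' :
  isomorphic R S -> isomorphic S R' -> isomorphic R R'.
Proof.
case=> f [bf fu fb] [g [bg gu gb]]; exists (g \o f); split.
- exact: bij_comp.
- by move=> i x /=; rewrite gu fu.
- by move=> i x y /=; rewrite gb fb.
Qed.

Lemma isomorphic_card R S : isomorphic R S -> #|R| = #|S|.
Proof. by case=> f [/bij_eq_card]. Qed.

Lemma isomorphic_embeds R S : isomorphic R S -> embeds R S.
Proof.
move=> isoRS; exists setT; apply: isomorphic_trans isoRS _.
exists (fun x => Sub x (in_setT x)); split=> //.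
by exists val => [x | x]; [rewrite SubK | apply: val_inj; rewrite SubK].
Qed.

Lemma embeds_trans S R R' : embeds R S -> embeds S R' -> embeds R R'.
Proof.
case=> A [f [bf fu fb]] [B [g [bg gu gb]]].
pose h (x : R) := val (g (val (f x))).
have hI : injective h.
  by move=> x y /val_inj /(bij_inj bg) /val_inj /(bij_inj bf).
exists [set h x | x in R].
exists (fun x => Sub (h x) (imset_f h (erefl (x \in R)))).
split.
- apply: inj_card_bij => [x y /(congr1 val) /hI //|].
  by rewrite card_sig card_imset.
- by move=> i x; apply: etrans (gu i (val (f x))) (fu i x).
- by move=> i x y; apply: etrans (gb i _ _) (fb i x y).
Qed.

Lemma induced_embeds R (X : {set R}) : embeds (induced X) R.
Proof. by exists X; apply: isomorphic_refl. Qed.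

(** The relations of a structure whose vertices are [0, ..., n - 1]. *)
Definition tables n : finType :=
  ({ffun usym s * 'I_n -> bool} * {ffun bsym s * 'I_n * 'I_n -> bool})%type.

Definition tabulated n (e : tables n) : structure s :=
  @Structure s 'I_n (fun i x => e.1 (i, x)) (fun i x y => e.2 (i, x, y)).

Lemma tabulate R : exists e : tables #|R|, isomorphic R (tabulated e).
Proof.
exists ([ffun p => urel R p.1 (enum_val p.2)],
        [ffun p => brel R p.1.1 (enum_val p.1.2) (enum_val p.2)]).
exists (@enum_rank R); split.
- by exists enum_val; [apply: enum_rankK | apply: enum_valK].
- by move=> i x /=; rewrite ffunE /= enum_rankK.
- by move=> i x y /=; rewrite ffunE /= !enum_rankK.
Qed.

(** A finite index type for all isomorphism types with fewer than [m]
    vertices. *)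
Definition code m : finType := {n : 'I_m & tables n}.

Definition decode m (e : code m) : structure s := tabulated (tagged e).

Lemma decode_onto m R : #|R| < m -> exists e : code m, isomorphic R (decode e).
Proof.
move=> ltRm; have [e iso_e] := tabulate R.
by exists (Tagged (fun n : 'I_m => tables n) (i := Ordinal ltRm) e).
Qed.

Lemma structure_enumeration :
  exists E : nat -> structure s, forall R, exists k, isomorphic R (E k).
Proof.
pose dflt := @Structure s void (fun _ _ => false) (fun _ _ _ => false).
pose E k := oapp (fun e : {n : nat & tables n} => tabulated (tagged e)) dflt
  (unpickle k).
exists E => R; have [e iso_e] := tabulate R.
by exists (pickle (Tagged (fun n => tables n) e)); rewrite /E pickleK.
Qed.

Lemma finitely_many_primes_lt C m :
    (forall R, C R -> prime_structure R -> #|R| < m) ->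
  finitely_many_primes C.
Proof.
move=> bound; exists #|code m|, (fun k => decode (enum_val k)) => R CR pR.
have [e iso_e] := decode_onto (bound R CR pR).
by exists (enum_rank e); rewrite enum_rankK.
Qed.

(** * Chains of hereditary classes *)

Lemma prime_of_size_in C m :
    hereditary C -> infinitely_many_primes C -> 2 < m ->
  exists R, [/\ C R, prime_structure R & m <= #|R| <= m.+1].
Proof.
move=> hC infC m_gt2.
have [R [CR pR leR]] : exists R, [/\ C R, prime_structure R & m <= #|R|].
  apply: contrapT => noR; apply: infC; apply: (@finitely_many_primes_lt _ m).
  move=> R CR pR; rewrite ltnNge; apply/negP => leR.
  by apply: noR; exists R.
have [|X sizeX pX] := @prime_of_size _ _ _ (@color_rev R) m (prime_in_setT pR).
  by rewrite m_gt2.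
exists (induced X); split; last by rewrite card_sig.
  exact: hC (induced_embeds X) CR.
exact: prime_induced.
Qed.

(** If every [e] of [F] failed for some class of the chain, the smallest of these
    finitely many classes would have no witness at all. *)
Lemma chain_common_witness (P : class s -> Prop) (F : finType)
    (Q : class s -> F -> Prop) :
    (forall D D', P D -> P D' -> subclass D D' \/ subclass D' D) ->
    (forall D D' e, subclass D D' -> Q D e -> Q D' e) ->
    (exists D, P D) -> (forall D, P D -> exists e, Q D e) ->
  exists e, forall D, P D -> Q D e.
Proof.
move=> totP monoQ [D0 PD0] exQ; apply: contrapT => noe.
have [D PD noD] : exists2 D, P D & forall e, e \in enum F -> ~ Q D e.
  elim: (enum F) => [|e r [D PD noD]]; first by exists D0.
  have [De PDe nQ] : exists2 De, P De & ~ Q De e.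
    apply: contrapT => noDe; apply: noe; exists e => D' PD'.
    by apply: contrapT => nQ; apply: noDe; exists D'.
  case: (totP D De PD PDe) => [sD|sD].
  - exists D => // e'; rewrite inE => /predU1P[->|/noD//].
    by move=> QD; apply: nQ; apply: monoQ QD.
  - exists De => // e'; rewrite inE => /predU1P[->//|/noD nQD].
    by move=> QD; apply: nQD; apply: monoQ QD.
have [e Qe] := exQ D PD.
by apply: (noD e) => //; rewrite mem_enum.
Qed.

(** For every [m > 2] the classes share a prime with [m] or [m.+1] vertices, up
    to isomorphism; this exceeds the sizes of any finite list of candidates
    when [m] is large. *)
Lemma chain_inter_infinitely_many (P : class s -> Prop) :
    (forall D D', P D -> P D' -> subclass D D' \/ subclass D' D) ->
    (exists D, P D) ->
    (forall D, P D -> hereditary D /\ infinitely_many_primes D) ->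
  infinitely_many_primes (fun R => forall D, P D -> D R).
Proof.
move=> totP [D0 PD0] goodP [n [reps coverP]].
(* [m] bounds the sizes of all [reps], and is large enough for
   [prime_of_size_in]. *)
pose m := maxn 3 (\max_(k < n) #|reps k|).+1.
pose Q D (e : code m.+2) :=
  exists R, [/\ D R, prime_structure R, m <= #|R| & isomorphic R (decode e)].
have [|||e Qe] := @chain_common_witness P _ Q totP.
- by move=> D D' e sD [R [DR pR mR isoR]]; exists R; split=> //; apply: sD.
- by exists D0.
- move=> D PD; have [hD infD] := goodP D PD.
  have [|R [DR pR /andP[mR Rm]]] := @prime_of_size_in D m hD infD.
    exact: leq_maxl.
  have [e isoR] := @decode_onto m.+2 R Rm.
  by exists e, R.
have [R [DR pR mR isoR]] := Qe D0 PD0.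
have [|k /isomorphic_card cardR] := coverP R _ pR.
  move=> D PD; have [R' [DR' _ _ isoR']] := Qe D PD.
  have [hD _] := goodP D PD; apply: hD DR'; apply: isomorphic_embeds.
  by apply: isomorphic_trans isoR _; apply: isomorphic_sym.
have : #|R| < m.
  apply: leq_trans (leq_maxr _ _); rewrite ltnS cardR.
  exact: (leq_bigmax (F := fun k => #|reps k|)).
by rewrite ltnNge mR.
Qed.

Definition avoid D R : class s := fun S => D S /\ ~ embeds R S.

Lemma avoid_hereditary D R : hereditary D -> hereditary (avoid D R).
Proof.
move=> hD S S' SS' [DS' nRS']; split; first exact: hD DS'.
by move=> RS; apply: nRS'; apply: embeds_trans SS'.
Qed.

(** A proper hereditary subclass [D'] of the limit [D] misses some [R] in [D],
    isomorphic to [E k] say. If [D'] had infinitely many primes, so would the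
    class obtained by discarding the structures above [E k] at stage [k], since
    it contains [D']; then they were discarded, and [R] is not in [D]. *)
Theorem contains_minimal_prime C :
    hereditary C -> infinitely_many_primes C ->
  exists D, subclass D C /\ minimal_prime D.
Proof.
move=> hC infC.
have [E enumE] := structure_enumeration.
pose step k D : class s :=
  if `[< infinitely_many_primes (avoid D (E k)) >] then avoid D (E k) else D.
pose F := fix F k := if k is k'.+1 then step k' (F k') else C.
have stepS k D : subclass (step k D) D.
  by rewrite /step; case: asboolP => _ S // [].
have FS i j : i <= j -> subclass (F j) (F i).
  elim: j => [|j IHj]; first by rewrite leqn0 => /eqP->.
  rewrite leq_eqVlt => /predU1P[-> //|/IHj sF] S FS; apply: sF.
  exact: stepS FS.
have goodF k : hereditary (F k) /\ infinitely_many_primes (F k).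
  elim: k => // k [hF infF]; rewrite /= /step; case: asboolP => // infA.
  by split=> //; apply: avoid_hereditary.
pose D : class s := fun R => forall D', (exists k, D' = F k) -> D' R.
have DF k : subclass D (F k) by move=> R; apply; exists k.
exists D; split; first exact: (DF 0).
split.
- move=> R S RS DS _ [k ->]; have [hF _] := goodF k.
  exact: hF RS (DF k S DS).
- apply: chain_inter_infinitely_many.
  + move=> _ _ [i ->] [j ->].
    by case: (leqP i j) => [ij|/ltnW ij]; [right | left]; apply: FS.
  + by exists C, 0.
  + by move=> _ [k ->].
- move=> D' hD' [sD' nsD]; apply: contrapT => infD'; apply: nsD => R DR.
  apply: contrapT => nD'R; have [k isoR] := enumE R.
  have sA : subclass D' (avoid (F k) (E k)).
    move=> S D'S; split; first exact: DF (sD' S D'S).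
    move=> /hD' /(_ D'S) D'E; apply: nD'R; apply: (hD' _ _ _ D'E).
    exact: isomorphic_embeds.
  have := DF k.+1 R DR; rewrite /= /step asboolT => [[_]|].
    by apply; apply/isomorphic_embeds/isomorphic_sym.
  by move=> [n [reps cov]]; apply: infD'; exists n, reps => S /sA; apply: cov.
Qed.

End Structures.

Theorem theorem6 :
  (forall (s : signature) (C : class s),
     hereditary C -> infinitely_many_primes C ->
     exists D : class s, subclass D C /\ minimal_prime D)
  /\
  (forall C : class graph_sig,
     (forall G, C G -> is_graph G) ->
     hereditary C -> infinitely_many_primes C ->
     exists D : class graph_sig, subclass D C /\ minimal_prime D).
Proof. by split=> [s C|C _]; apply: contains_minimal_prime. Qed.
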